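(* There is an algorithm which, given as input two ordered rooted binary trees $S$ and $T$, each with $n$ internal nodes, computes in time $O(n)$ a $2$-approximation of their rotation distance, i.e. a number $A$ satisfying $$d_R(S,T) \;\le\; A \;\le\; 2\, d_R(S,T).$$
   Context: A tree here is an extended binary tree: a finite ordered (plane) rooted binary tree in which every interior (internal) node has exactly two children, a left child and a right child. A tree with $n$ interior nodes has $n+1$ leaves, numbered $1,\dots,n+1$ in left-to-right order. Rotations: write $(X,Y)$ for the tree or subtree whose root has left subtree $X$ and right subtree $Y$. A right rotation at a node whose left child is an interior node replaces the subtree $((A,B),C)$ rooted at that node by $(A,(B,C))$, leaving the rest of the tree unchanged; here $A,B,C$ are arbitrary subtrees (possibly single leaves). A left rotation is the inverse operation, replacing $(A,(B,C))$ by $((A,B),C)$. The rotation distance $d_R(S,T)$ between two trees with the same number of leaves is the minimum number of (left or right) rotations needed to transform $S$ into $T$. Running time is measured in the usual unit-cost random-access machine model (words of $O(\log n)$ bits), with the trees given as standard pointer-based structures. *)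

(* Defs.v *)
From mathcomp Require Import all_boot.

Set Implicit Arguments.
Unset Strict Implicit.
Unset Printing Implicit Defensive.

(* Leaves carry no labels: their left-to-right numbering is implicit. *)
Inductive tree : Type :=
| Leaf
| Node of tree & tree.

Fixpoint internal_nodes (t : tree) : nat :=
  if t is Node l r then (internal_nodes l + internal_nodes r).+1 else 0.

Inductive right_rotation : tree -> tree -> Prop :=
| RightRotationHere A B C :
    right_rotation (Node (Node A B) C) (Node A (Node B C))
| RightRotationLeft l l' r :
    right_rotation l l' -> right_rotation (Node l r) (Node l' r)
| RightRotationRight l r r' :
    right_rotation r r' -> right_rotation (Node l r) (Node l r').

Definition rotation (S T : tree) : Prop :=
  right_rotation S T \/ right_rotation T S.

Fixpoint rotates_in (k : nat) (S T : tree) : Prop :=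
  if k is k'.+1 then exists2 U, rotation S U & rotates_in k' U T else S = T.

(* The distance as a functional relation: d is the least length of a sequence
   of rotations from S to T. *)
Definition rotation_distance (S T : tree) (d : nat) : Prop :=
  rotates_in d S T /\ forall k, rotates_in k S T -> d <= k.

(* A unit-cost random-access machine with the Cook-Reckhow operations, acting
   on a register file named by the program text and on a memory addressed
   through registers.  Words are the naturals below 2 ^ w; subtraction is
   truncated at 0. *)
Inductive instr : Type :=
| Const (dst c : nat)
| Plus (dst x y : nat)
| Minus (dst x y : nat)
| Read (dst addr : nat)
| Write (addr src : nat)
| JumpPos (x target : nat)
| Halt.

Definition program := seq instr.

Record state := State {
  pc : nat;
  reg : nat -> nat;
  mem : nat -> nat
}.

Definition update (f : nat -> nat) (i v : nat) : nat -> nat :=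
  fun j => if j == i then v else f j.

(* None is a crash: a halted or exhausted program, or a result that does not
   fit in a word.  If all registers and cells hold words, then so they do after
   a step; in particular every address used is a word. *)
Definition step (w : nat) (P : program) (s : state) : option state :=
  let: State i r m := s in
  let set d v :=
    if v < 2 ^ w then Some (State i.+1 (update r d v) m) else None in
  match onth P i with
  | Some (Const d c) => set d c
  | Some (Plus d x y) => set d (r x + r y)
  | Some (Minus d x y) => set d (r x - r y)
  | Some (Read d a) => set d (m (r a))
  | Some (Write a x) => Some (State i.+1 r (update m (r a) (r x)))
  | Some (JumpPos x l) => Some (State (if 0 < r x then l else i.+1) r m)
  | Some Halt | None => None
  end.

Fixpoint steps (w : nat) (P : program) (t : nat) (s : state) : option state :=
  if t is t'.+1 then obind (steps w P t') (step w P s) else Some s.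

Definition outputs_within (w : nat) (P : program) (time : nat) (s : state)
    (A : nat) : Prop :=
  exists t s', [/\ t <= time, steps w P t s = Some s',
                   onth P (pc s') = Some Halt & reg s' 0 = A].

(* Pointer structures: an internal node is a record of two consecutive cells,
   holding the pointers to its left and right children; 0 is the null pointer
   and stands for a leaf. *)
Fixpoint stored_at (m : nat -> nat) (t : tree) (p : nat) : Prop :=
  if t is Node l r
  then [/\ p <> 0, stored_at m l (m p) & stored_at m r (m p.+1)]
  else p = 0.

Fixpoint cells (m : nat -> nat) (t : tree) (p : nat) : seq nat :=
  if t is Node l r
  then [:: p, p.+1 & cells m l (m p) ++ cells m r (m p.+1)]
  else [::].

(* The records are pairwise disjoint and otherwise placed arbitrarily below the
   address free, from which on memory is available to the program; the contents
   of the cells outside the records are arbitrary words. *)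
Definition valid_input (w : nat) (S T : tree) (pS pT free : nat)
    (m : nat -> nat) : Prop :=
  [/\ stored_at m S pS /\ stored_at m T pT,
      uniq (cells m S pS ++ cells m T pT),
      all (fun a => a < free) (cells m S pS ++ cells m T pT),
      free < 2 ^ w
    & forall a, m a < 2 ^ w].

(* The program is told neither the number of nodes nor the word length. *)
Definition initial_state (pS pT free : nat) (m : nat -> nat) : state :=
  State 0 (nth 0 [:: pS; pT; free]) m.

(* The number of bits of n, and 1 for n = 0. *)
Definition bits (n : nat) : nat := (trunc_log 2 n).+1.

(* Main.v *)
(* Identify an internal node with the interval of leaves below it.  A rotation
   replaces a single interval, so d_R(S, T) is at least the number e of
   intervals of S that are not intervals of T.  Conversely, by at most e
   rotations each of S and T can be brought, keeping all common intervals, into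
   a tree in which every internal left child is a common interval, and there is
   only one such tree.  Hence 2 e is a 2-approximation.  To compute e in linear
   time, note that a node of T which is a left child is the longest interval of
   T with its last leaf, and one which is a right child the longest with its
   first leaf: two tables over the leaves, filled by a postorder traversal of T,
   decide in constant time whether an interval of S occurs in T. *)
Require Import Defs.
From mathcomp Require Import all_boot zify.
From Stdlib Require Import Classical.

Set Implicit Arguments.
Unset Strict Implicit.
Unset Printing Implicit Defensive.

(** * Rotations and intervals *)

(* The internal nodes as pairs of the first and the last leaf below them, the
   leaves of [t] being numbered from [c] on. *)
Fixpoint intervals (c : nat) (t : tree) : seq (nat * nat) :=
  if t is Node l r
  then (c, c + internal_nodes t)
         :: intervals c l ++ intervals (c + internal_nodes l).+1 r
  else [::].

(* The intervals of the internal nodes that are left children; [take 1] yields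
   the root of [l] if that is not a leaf. *)
Fixpoint left_intervals (c : nat) (t : tree) : seq (nat * nat) :=
  if t is Node l r
  then take 1 (intervals c l) ++ left_intervals c l
         ++ left_intervals (c + internal_nodes l).+1 r
  else [::].

Lemma intervals_bounds c t i j :
  (i, j) \in intervals c t -> c <= i < j /\ j <= c + internal_nodes t.
Proof.
elim: t c => [|l IHl r IHr] c //=.
rewrite inE mem_cat => /orP[/eqP[-> ->]|/orP[/IHl|/IHr]]; lia.
Qed.

Lemma size_intervals c t : size (intervals c t) = internal_nodes t.
Proof. by elim: t c => [|l IHl r IHr] c //=; rewrite size_cat IHl IHr. Qed.

Lemma intervals_uniq c t : uniq (intervals c t).
Proof.
elim: t c => [|l IHl r IHr] c //=.
rewrite mem_cat cat_uniq IHl IHr andbT negb_or; apply/and3P; split.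
- apply/andP; split; apply/negP=> /intervals_bounds; lia.
- by [].
- by apply/hasPn=> -[i j] /intervals_bounds hr; apply/negP=> /intervals_bounds; lia.
Qed.

Lemma left_intervals_sub c t : {subset left_intervals c t <= intervals c t}.
Proof.
elim: t c => [|l IHl r IHr] c x //=; rewrite inE !mem_cat.
by case/or3P=> [/mem_take ->|/IHl ->|/IHr ->]; rewrite !orbT.
Qed.

Lemma right_rotation_internal_nodes S T :
  right_rotation S T -> internal_nodes S = internal_nodes T.
Proof. by elim=> [A B C|l l' r _ /= ->|l r r' _ /= ->] //=; lia. Qed.

Lemma rotation_internal_nodes S T :
  rotation S T -> internal_nodes S = internal_nodes T.
Proof. by case=> /right_rotation_internal_nodes. Qed.

(** A right rotation only exchanges the interval of [Node A B] for that of [Node B C], so any count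
    moves by at most one. Both inequalities are shown for right rotations, which covers left ones
    too. *)
Lemma rotation_count_intervals p c S T : rotation S T ->
  count p (intervals c S) <= (count p (intervals c T)).+1.
Proof.
suff h S' T' : right_rotation S' T' ->
    count p (intervals c S') <= (count p (intervals c T')).+1 /\
    count p (intervals c T') <= (count p (intervals c S')).+1.
  by case=> /h[].
move=> rST; elim: rST c => [A B C|l l' r rl IH|l r r' rr IH] c /=.
- rewrite !count_cat /= !count_cat.
  have -> : (c + (internal_nodes A + internal_nodes B).+1).+1
          = ((c + internal_nodes A).+1 + internal_nodes B).+1 by lia.
  have -> : c + ((internal_nodes A + internal_nodes B).+1 + internal_nodes C).+1
          = c + (internal_nodes A + (internal_nodes B + internal_nodes C).+1).+1
    by lia.
  by do 3!(move: (p (_, _)) => ?); lia.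
- rewrite !count_cat (right_rotation_internal_nodes rl).
  by have := IH c; lia.
- rewrite !count_cat (right_rotation_internal_nodes rr).
  by have := IH (c + internal_nodes l).+1; lia.
Qed.

Lemma rotates_in_trans k1 k2 S U T :
  rotates_in k1 S U -> rotates_in k2 U T -> rotates_in (k1 + k2) S T.
Proof.
elim: k1 S => [|k1 IH] S /=; first by move=> ->.
by case=> V rSV /IH h /h; exists V.
Qed.

Lemma rotates_in_sym k S T : rotates_in k S T -> rotates_in k T S.
Proof.
elim: k S => [|k IH] S; first by move=> /= ->.
case=> U rSU /IH rTU; rewrite -addn1; apply: rotates_in_trans rTU _.
by exists S => //; case: rSU; [right|left].
Qed.

Lemma rotates_in_right k l r r' :
  rotates_in k r r' -> rotates_in k (Node l r) (Node l r').
Proof.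
elim: k r => [|k IH] r /=; first by move=> ->.
by case=> U h /IH h'; exists (Node l U) => //; case: h => h; [left|right]; constructor.
Qed.

Lemma rotates_in_left k l l' r :
  rotates_in k l l' -> rotates_in k (Node l r) (Node l' r).
Proof.
elim: k l => [|k IH] l /=; first by move=> ->.
by case=> U h /IH h'; exists (Node U r) => //; case: h => h; [left|right]; constructor.
Qed.

Lemma rotates_in_internal_nodes k S T :
  rotates_in k S T -> internal_nodes S = internal_nodes T.
Proof.
elim: k S => [|k IH] S /=; first by move=> ->.
by case=> U /rotation_internal_nodes -> /IH.
Qed.

(** The count vanishes at [T] and drops by at most one per rotation. *)
Lemma rotates_in_lower_bound k S T : rotates_in k S T ->
  count [predC intervals 0 T] (intervals 0 S) <= k.
Proof.
elim: k S => [|k IH] S /=.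
  by move=> ->; rewrite leqNgt -has_count; apply/hasPn=> x hx /=; rewrite negbK.
case=> U rSU /IH; have := rotation_count_intervals [predC intervals 0 T] 0 rSU.
by rewrite /=; lia.
Qed.

(** * Normal forms whose internal left children all lie in [K] *)

Section Normalization.

Variable K : pred (nat * nat).

Definition normalizes c (k : nat) (S T : tree) : Prop :=
  rotates_in k S T /\
  forall x, x \in intervals c S -> K x -> x \in intervals c T.

Lemma normalizes_trans c k1 k2 S U T :
  normalizes c k1 S U -> normalizes c k2 U T -> normalizes c (k1 + k2) S T.
Proof.
move=> [r1 h1] [r2 h2]; split; first exact: rotates_in_trans r2.
by move=> x hx Kx; apply: h2 => //; apply: h1.
Qed.

Lemma normalizes_right c k l r r' : normalizes (c + internal_nodes l).+1 k r r' ->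
  normalizes c k (Node l r) (Node l r').
Proof.
move=> [hr h]; split; first exact: rotates_in_right.
move=> x /=; rewrite !inE !mem_cat (rotates_in_internal_nodes hr).
by case/or3P=> [->|->|/h hx /hx ->]; rewrite ?orbT.
Qed.

Lemma normalizes_left c k l l' r : normalizes c k l l' ->
  normalizes c k (Node l r) (Node l' r).
Proof.
move=> [hl h]; split; first exact: rotates_in_left.
move=> x /=; rewrite !inE !mem_cat (rotates_in_internal_nodes hl).
by case/or3P=> [->|/h hx /hx ->|->]; rewrite ?orbT.
Qed.

Lemma normalizes_rotation c A B C : ~~ K (c, c + (internal_nodes A + internal_nodes B).+1) ->
  normalizes c 1 (Node (Node A B) C) (Node A (Node B C)).
Proof.
move=> nK; split; first by exists (Node A (Node B C)) => //; left; constructor.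
move=> x /=; rewrite !inE !mem_cat /= !inE !mem_cat.
have -> : (c + (internal_nodes A + internal_nodes B).+1).+1
          = ((c + internal_nodes A).+1 + internal_nodes B).+1 by lia.
have -> : c + ((internal_nodes A + internal_nodes B).+1 + internal_nodes C).+1
          = c + (internal_nodes A + (internal_nodes B + internal_nodes C).+1).+1
    by lia.
case/or3P=> [->//|/eqP-> Kx|]; first by rewrite Kx in nK.
by rewrite -orbA => /or3P[] ->; rewrite ?orbT.
Qed.

(* Rotating right at a left child outside [K] moves that node to the right
   spine, so each node outside [K] is rotated at most once.  The second claim
   is the one with an accumulator [R] that makes the induction go through. *)
Lemma normalize_aux t c :
  (exists k t', [/\ normalizes c k t t',
     k <= count (predC K) (behead (intervals c t)) &
     {subset left_intervals c t' <= K}]) /\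
  (forall R, exists k V, [/\ normalizes c k (Node t R) V,
     k <= count (predC K) (intervals c t) &
     forall x, x \in left_intervals c V ->
       K x \/ x \in left_intervals (c + internal_nodes t).+1 R]).
Proof.
elim: t c => [|l IHl r IHr] c.
  split; first by exists 0, Leaf.
  by move=> R; exists 0, (Node Leaf R); split=> // x; right.
have root : exists k t', [/\ normalizes c k (Node l r) t',
     k <= count (predC K) (behead (intervals c (Node l r))) &
     {subset left_intervals c t' <= K}].
  (* The right subtree is normalized first and then serves as the accumulator for the left one. *)
  have [[k1 [r' [n1 b1 s1]]] _] := IHr (c + internal_nodes l).+1.
  have [_ /(_ r')[k2 [V [n2 b2 s2]]]] := IHl c.
  exists (k1 + k2), V; split.
  - by apply: normalizes_trans n2; apply: normalizes_right.
  - rewrite /= count_cat; move: b1 b2.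
    by case: (intervals _ r) => [|x s] /=; lia.
  - by move=> x /s2[//|/s1].
split=> // R.
have [Kroot|nKroot] := boolP (K (c, c + (internal_nodes l + internal_nodes r).+1)).
  (* A node in [K] may remain a left child, so it is normalized in place and [R] is untouched. *)
  have [k [t' [n b s]]] := root.
  exists k, (Node t' R); split; first exact: normalizes_left.
    by move: b => /=; lia.
  have et := rotates_in_internal_nodes n.1.
  move=> x /=; rewrite !mem_cat; case/or3P.
  - case: t' et {n s} => [|l' r'] //=; rewrite take0 inE => -[e] /eqP->.
    by left; rewrite -e.
  - by move/s; left.
  - by rewrite -et; right.
(* One rotation gives [Node l (Node r R)]; then [r] is absorbed into the accumulator, and [l] after
   it. *)
have [_ /(_ R)[k1 [V1 [n1 b1 s1]]]] := IHr (c + internal_nodes l).+1.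
have [_ /(_ V1)[k2 [V [n2 b2 s2]]]] := IHl c.
exists (1 + (k1 + k2)), V; split.
- apply: normalizes_trans (normalizes_rotation _ nKroot) _.
  by apply: normalizes_trans n2; apply: normalizes_right.
- by rewrite /= nKroot count_cat; lia.
- move=> x /s2[|/s1[|]]; try by left.
  rewrite [internal_nodes (Node _ _)]/= => hx; right.
  by congr (_ \in left_intervals _.+1 _): hx; lia.
Qed.

Lemma normalize t c : exists k t', [/\ normalizes c k t t',
  k <= count (predC K) (intervals c t) & {subset left_intervals c t' <= K}].
Proof.
have [[k [t' [n b s]]] _] := normalize_aux t c; exists k, t'; split=> //.
by move: b; case: (intervals c t) => [|x u] /=; lia.
Qed.

End Normalization.

(** * Uniqueness of the normal form *)

Lemma left_intervals_root c l r : l <> Leaf ->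
  (c, c + internal_nodes l) \in left_intervals c (Node l r).
Proof. by case: l => [//|l1 l2] _ /=; rewrite inE eqxx. Qed.

(** The interval of [l'] starts at [c]: it is too short to be the root of [Node l r], and those of
    [r] start later, so it lies within [l]. *)
Lemma left_size_le c l r l' r' :
  internal_nodes (Node l r) = internal_nodes (Node l' r') ->
  {subset left_intervals c (Node l' r') <= intervals c (Node l r)} ->
  internal_nodes l' <= internal_nodes l.
Proof.
move=> /= e sub; case: (boolP (internal_nodes l' == 0)) => [/eqP->//|n0].
have /sub : (c, c + internal_nodes l') \in left_intervals c (Node l' r').
  by apply: left_intervals_root => l0; rewrite l0 in n0.
rewrite /= inE mem_cat; case/or3P.
- by move/eqP=> []; lia.
- by case/intervals_bounds; lia.
- by case/intervals_bounds; lia.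
Qed.

(* The left child of the root is the longest proper interval starting at the
   first leaf, in both trees. *)
Lemma left_intervals_inj c S T : internal_nodes S = internal_nodes T ->
  {subset left_intervals c S <= intervals c T} ->
  {subset left_intervals c T <= intervals c S} -> S = T.
Proof.
elim: S c T => [|l IHl r IHr] c [|l' r'] // e sST sTS.
have el : internal_nodes l = internal_nodes l'.
  apply/eqP; rewrite eqn_leq; apply/andP; split.
    exact: left_size_le (esym e) sST.
  exact: left_size_le e sTS.
have er : internal_nodes r = internal_nodes r' by move: e => /=; lia.
have restrict l1 r1 l2 r2 : internal_nodes l1 = internal_nodes l2 ->
    internal_nodes r1 = internal_nodes r2 ->
    {subset left_intervals c (Node l1 r1) <= intervals c (Node l2 r2)} ->
    {subset left_intervals c l1 <= intervals c l2} /\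
    {subset left_intervals (c + internal_nodes l1).+1 r1
      <= intervals (c + internal_nodes l1).+1 r2}.
  move=> e1 e2 sub; split=> -[i j] hij.
    have bd := intervals_bounds (left_intervals_sub hij).
    have /sub : (i, j) \in left_intervals c (Node l1 r1) by rewrite /= !mem_cat hij !orbT.
    rewrite /= inE mem_cat; case/or3P=> [/eqP[]| //|/intervals_bounds]; lia.
  have bd := intervals_bounds (left_intervals_sub hij).
  have /sub : (i, j) \in left_intervals c (Node l1 r1) by rewrite /= !mem_cat hij !orbT.
  rewrite /= inE mem_cat e1; case/or3P=> [/eqP[]|/intervals_bounds| //]; lia.
have [hl hr] := restrict l r l' r' el er sST.
have [hl' hr'] := restrict l' r' l r (esym el) (esym er) sTS.
by rewrite (IHl c l') // (IHr (c + internal_nodes l).+1 r') // el.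
Qed.

(** * The upper bound and the approximation ratio *)

Lemma count_notin_sym (I : eqType) (s1 s2 : seq I) :
  uniq s1 -> uniq s2 -> size s1 = size s2 ->
  count [predC s2] s1 = count [predC s1] s2.
Proof.
move=> u1 u2 es.
have : count (mem s2) s1 = count (mem s1) s2.
  rewrite -!size_filter; apply/perm_size/uniq_perm; rewrite ?filter_uniq //.
  by move=> x; rewrite !mem_filter andbC.
have := count_predC (mem s2) s1; have := count_predC (mem s1) s2.
have -> : count (predC (mem s2)) s1 = count [predC s2] s1 by apply: eq_count.
have -> : count (predC (mem s1)) s2 = count [predC s1] s2 by apply: eq_count.
lia.
Qed.

Lemma rotates_in_upper_bound S T : internal_nodes S = internal_nodes T ->
  exists2 k, rotates_in k S T &
    k <= 2 * count [predC intervals 0 T] (intervals 0 S).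
Proof.
move=> e; pose K := [pred x | (x \in intervals 0 S) && (x \in intervals 0 T)].
have [k1 [S' [[r1 h1] b1 s1]]] := normalize K S 0.
have [k2 [T' [[r2 h2] b2 s2]]] := normalize K T 0.
(* Left intervals of [S'] are common to [S] and [T], hence survive in [T'], and vice versa. *)
have eST : S' = T'.
  apply: (@left_intervals_inj 0).
  - by rewrite -(rotates_in_internal_nodes r1) -(rotates_in_internal_nodes r2).
  - by move=> x /s1 Kx; apply: h2 => //; case/andP: Kx.
  - by move=> x /s2 Kx; apply: h1 => //; case/andP: Kx.
exists (k1 + k2).
  by apply: rotates_in_trans r1 _; rewrite eST; apply: rotates_in_sym.
have c1 : count (predC K) (intervals 0 S)
        = count [predC intervals 0 T] (intervals 0 S).
  by apply: eq_in_count => x /= ->.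
have c2 : count (predC K) (intervals 0 T)
        = count [predC intervals 0 S] (intervals 0 T).
  by apply: eq_in_count => x /= ->; rewrite andbT.
(* [S] and [T] have equally many intervals, so both normalization costs have the same bound. *)
have := count_notin_sym (intervals_uniq 0 S) (intervals_uniq 0 T).
by rewrite !size_intervals => /(_ e) e2; move: b1 b2; rewrite c1 c2 -e2; lia.
Qed.

(** Excluded middle supplies the minimum for an arbitrary, possibly undecidable, [Q]. *)
Lemma least_witness (Q : nat -> Prop) k : Q k ->
  exists2 d, Q d & forall j, Q j -> d <= j.
Proof.
elim/ltn_ind: k => k IH Qk.
have [[j [jk Qj]]|none] := classic (exists j, j < k /\ Q j); first exact: IH Qj.
exists k => // j Qj; rewrite leqNgt; apply/negP=> jk.
by apply: none; exists j.
Qed.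

Lemma rotation_distance_approximation S T : internal_nodes S = internal_nodes T ->
  let A := 2 * count [predC intervals 0 T] (intervals 0 S) in
  exists2 d, rotation_distance S T d & d <= A <= 2 * d.
Proof.
move=> e A; have [k rk kA] := rotates_in_upper_bound e.
have [d rd dmin] := least_witness (Q := fun k => rotates_in k S T) rk.
exists d; first by split.
by rewrite (leq_trans (dmin k rk) kA) leq_mul2l rotates_in_lower_bound.
Qed.

(** * The machine and its program *)

Section Execution.

Variables (w : nat) (P : program).

(** Presents the register update as data, so that a single rule covers all four register-writing
    instructions. *)
Definition result (l : seq nat) (m : nat -> nat) (ins : instr) :
    option (nat * nat) :=
  match ins with
  | Const d c => Some (d, c)
  | Plus d x y => Some (d, nth 0 l x + nth 0 l y)
  | Minus d x y => Some (d, nth 0 l x - nth 0 l y)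
  | Read d a => Some (d, m (nth 0 l a))
  | _ => None
  end.

(* The register file is carried as a finite list, so that lookups in it
   compute. *)
Definition reaches (b i : nat) (l : seq nat) (m : nat -> nat)
    (Q : nat -> seq nat -> (nat -> nat) -> Prop) : Prop :=
  forall r, r =1 nth 0 l -> exists t i' r' l' m',
    [/\ t <= b, steps w P t (State i r m) = Some (State i' r' m'),
        r' =1 nth 0 l' & Q i' l' m'].

Lemma reaches_done b i l m (Q : nat -> seq nat -> (nat -> nat) -> Prop) :
  Q i l m -> reaches b i l m Q.
Proof. by move=> h r hr; exists 0, i, r, l, m. Qed.

Lemma steps_add t1 t2 s :
  steps w P (t1 + t2) s = obind (steps w P t2) (steps w P t1 s).
Proof. by elim: t1 s => //= t1 IH s; case: step => //=. Qed.

Lemma reaches_bind b2 b1 b i l m Q1 Q :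
  reaches b1 i l m Q1 -> b1 + b2 <= b ->
  (forall i' l' m', Q1 i' l' m' -> reaches b2 i' l' m' Q) ->
  reaches b i l m Q.
Proof.
move=> h1 hb h2 r /h1[t1 [i1 [r1 [l1 [m1 [b1t s1 e1 /h2/(_ _ e1)]]]]]].
case=> t2 [i2 [r2 [l2 [m2 [b2t s2 e2 q2]]]]].
exists (t1 + t2), i2, r2, l2, m2; split=> //; first lia.
by rewrite steps_add s1.
Qed.

Lemma reaches_step b i l m i1 l1 m1 Q :
  (forall r, r =1 nth 0 l ->
     exists2 r1, step w P (State i r m) = Some (State i1 r1 m1) & r1 =1 nth 0 l1) ->
  reaches b i1 l1 m1 Q -> reaches b.+1 i l m Q.
Proof.
move=> h1 h r /h1[r1 s1 /h[t [i2 [r2 [l2 [m2 [bt s2 e2 q2]]]]]]].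
by exists t.+1, i2, r2, l2, m2; split=> //;
   rewrite -[LHS]/(obind (steps w P t) (step w P (State i r m))) s1.
Qed.

Lemma reaches_result v b i l m d Q :
  obind (result l m) (onth P i) = Some (d, v) -> v < 2 ^ w ->
  reaches b i.+1 (set_nth 0 l d v) m Q -> reaches b.+1 i l m Q.
Proof.
move=> h hv; apply: reaches_step => r hr; exists (update r d v).
  by rewrite /step; case: (onth P i) h => // -[] //= *;
     rewrite ?hr; match goal with H : Some _ = Some _ |- _ => case: H => -> -> end;
     rewrite hv.
by move=> x; rewrite nth_set_nth /update /= hr.
Qed.

Lemma reaches_write b i l m a x Q :
  onth P i = Some (Write a x) ->
  reaches b i.+1 l (update m (nth 0 l a) (nth 0 l x)) Q -> reaches b.+1 i l m Q.
Proof.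
by move=> h; apply: reaches_step => r hr; exists r => //; rewrite /step h !hr.
Qed.

Lemma reaches_jump b i l m x j Q :
  onth P i = Some (JumpPos x j) -> 0 < nth 0 l x ->
  reaches b j l m Q -> reaches b.+1 i l m Q.
Proof.
by move=> h x0; apply: reaches_step => r hr; exists r => //; rewrite /step h hr x0.
Qed.

Lemma reaches_pass b i l m x j Q :
  onth P i = Some (JumpPos x j) -> nth 0 l x = 0 ->
  reaches b i.+1 l m Q -> reaches b.+1 i l m Q.
Proof.
by move=> h x0; apply: reaches_step => r hr; exists r => //; rewrite /step h hr x0.
Qed.

End Execution.

(* Registers: 0 the answer, 2 the base q of the work space, 3 the address
   of the current leaf, 4 the stack pointer, 5 and 6 the constants 1 and 6,
   7 the offset at which the pass writes, 8 the root of S, 15 zero.  The work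
   space consists of blocks of 6 cells.  Cells 0 and 1 of block k hold the k-th
   stack item: a pointer to a subtree still to be visited and 0, or an unused
   cell and the address of the first leaf of a node whose subtrees have been
   visited.  Cells 2 and 3 hold, after the pass over T, the first leaf of the
   longest interval of T ending at leaf k and the last leaf of the longest one
   starting there; the pass over S writes to cells 4 and 5, which are not
   read. *)
Definition prog : program :=
  [:: Const 5 1; Const 6 6; Const 7 2; Plus 8 0 15; Const 0 0; Plus 2 2 5;
  (* 6: start a pass over the tree in register 1 *)
      Plus 3 2 15; Plus 4 2 15; Write 4 1; Plus 11 4 5; Write 11 15; Plus 4 4 6;
  (* 12: pop *)
      Minus 4 4 6; Read 9 4; Plus 11 4 5; Read 10 11; JumpPos 10 38; JumpPos 9 24;
  (* 18: leaf *)
      Plus 11 3 7; Write 11 3; Plus 11 11 5; Write 11 3; Plus 3 3 6; JumpPos 5 61;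
  (* 24: internal node *)
      Write 11 3; Plus 4 4 6; Plus 12 9 5; Read 12 12; Write 4 12; Plus 11 4 5;
      Write 11 15; Plus 4 4 6; Read 12 9; Write 4 12; Plus 11 4 5; Write 11 15;
      Plus 4 4 6; JumpPos 5 12;
  (* 38: both subtrees of a node done *)
      Minus 9 3 6; Plus 11 9 7; Write 11 10; Plus 11 10 7; Plus 11 11 5;
      Write 11 9; Const 13 2;
      Plus 11 9 13; Read 12 11; Minus 11 12 10; Minus 14 10 12; Plus 11 11 14;
      JumpPos 11 52; JumpPos 5 61;
      Plus 11 10 13; Plus 11 11 5; Read 12 11; Minus 11 12 9; Minus 14 9 12;
      Plus 11 11 14; JumpPos 11 60; JumpPos 5 61;
      Plus 0 0 13;
  (* 61: loop while the stack is not empty *)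
      Minus 11 4 2; JumpPos 11 12;
      Const 13 4; Minus 11 13 7; JumpPos 11 67; Halt;
      Const 7 4; Plus 1 8 15; JumpPos 5 6].

(** The program writes only in the work space above the records, so both input trees survive every
    phase. *)
Lemma stored_at_frame (f : nat) m m' t p :
  (forall a, a < f -> m' a = m a) -> all (fun a => a < f) (cells m t p) ->
  stored_at m t p -> stored_at m' t p /\ cells m' t p = cells m t p.
Proof.
move=> e; elim: t p => [|l IHl r IHr] p //= /and3P[p0 p1].
rewrite all_cat => /andP[hl hr] [pn sl sr].
rewrite !e //; by have [? ->] := IHl _ hl sl; have [? ->] := IHr _ hr sr.
Qed.

(* [a] is the encoding of leaves by addresses; [L] and [R] are the tables. *)
Definition tracks (a L R : nat -> nat) (i : nat) (t : tree) : Prop :=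
  [/\ forall k, i <= k <= i + internal_nodes t ->
        exists2 j, L k = a j & j = k \/ (j, k) \in intervals i t,
      forall k, i <= k <= i + internal_nodes t ->
        exists2 j, R k = a j & j = k \/ (k, j) \in intervals i t,
      forall x y, (x, y) \in intervals i t -> L y = a x \/ R x = a y
    & L (i + internal_nodes t) = a i /\ R i = a (i + internal_nodes t)].

Lemma tracks_ext a L R L' R' i t :
  (forall k, i <= k <= i + internal_nodes t -> L' k = L k /\ R' k = R k) ->
  tracks a L R i t -> tracks a L' R' i t.
Proof.
move=> e [hL hR h [rL rR]]; split.
- by move=> k hk; have [-> _] := e k hk; apply: hL.
- by move=> k hk; have [_ ->] := e k hk; apply: hR.
- move=> x y hxy; have b := intervals_bounds hxy.
  by have [|-> _] := e y; [lia|]; have [|_ ->] := e x; [lia|]; apply: h.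
- by have [|-> _] := e (i + internal_nodes t); [lia|]; have [|_ ->] := e i; [lia|].
Qed.

(* A node of [l] that starts at [i] and occurs in [R] is the root of [l], which
   also occurs in [L]; so nothing is lost when [R i] is overwritten, and
   likewise for [r] and [L]. *)
Lemma tracks_node a L R i l r : injective a ->
  tracks a L R i l -> tracks a L R (i + internal_nodes l).+1 r ->
  tracks a (update L (i + (internal_nodes l + internal_nodes r).+1) (a i))
    (update R i (a (i + (internal_nodes l + internal_nodes r).+1)))
    i (Node l r).
Proof.
move=> inj [lL lR lh [llL llR]] [rL rR rh [rrL rrR]].
split; rewrite /update /=.
- move=> k hk; case: eqP => [->|nk].
    by exists i => //; right; rewrite inE eqxx.
  have [kl|kr] := leqP k (i + internal_nodes l).
    have [|j e hj] := lL k; first lia.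
    by exists j => //; case: hj => hj; [left|right; rewrite inE mem_cat hj !orbT].
  have [|j e hj] := rL k; first lia.
  by exists j => //; case: hj => hj; [left|right; rewrite inE mem_cat hj !orbT].
- move=> k hk; case: eqP => [->|nk].
    by exists (i + (internal_nodes l + internal_nodes r).+1) => //; right; rewrite inE eqxx.
  have [kl|kr] := leqP k (i + internal_nodes l).
    have [|j e hj] := lR k; first lia.
    by exists j => //; case: hj => hj; [left|right; rewrite inE mem_cat hj !orbT].
  have [|j e hj] := rR k; first lia.
  by exists j => //; case: hj => hj; [left|right; rewrite inE mem_cat hj !orbT].
- move=> x y; rewrite inE mem_cat; case/or3P.
  + by case/eqP=> -> ->; rewrite !eqxx; left.
  + move=> hxy; have b := intervals_bounds hxy.
    case: (y =P _) => [|_]; first lia.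
    case: (x =P i) => [xi|_]; last exact: lh.
    subst x; left; have [//|] := lh _ _ hxy.
    by rewrite llR => /inj <-.
  + move=> hxy; have b := intervals_bounds hxy.
    case: (x =P i) => [|_]; first lia.
    case: (y =P _) => [yi|_]; last exact: rh.
    right; have [|//] := rh _ _ hxy.
    rewrite yi (_ : i + _ = (i + internal_nodes l).+1 + internal_nodes r); last lia.
    by rewrite rrL => /inj <-.
- by rewrite !eqxx.
Qed.

(** A table entry is either the leaf itself, excluded by [i < j], or the other end of a genuine
    interval; conversely each interval is recorded in at least one table. *)
Lemma tracks_mem a L R t i j n : injective a -> internal_nodes t = n ->
  tracks a L R 0 t -> i < j <= n ->
  ((L j == a i) || (R i == a j)) = ((i, j) \in intervals 0 t).
Proof.
move=> inj tn [hL hR h _] ij; apply/idP/idP.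
  case/orP=> /eqP e.
    have [|k e' [kj|//]] := hL j; first lia.
      by move: e' ij; rewrite e kj => /inj ->; lia.
    by move: e'; rewrite e => /inj ->.
  have [|k e' [kj|//]] := hR i; first lia.
    by move: e' ij; rewrite e kj => /inj ->; lia.
  by move: e'; rewrite e => /inj ->.
by case/h=> ->; rewrite eqxx ?orbT.
Qed.

(** * Execution of one pass over a tree *)

Section Pass.

Variables (w q pS N : nat).
Hypothesis space : q + 6 * N + 6 < 2 ^ w.
Hypothesis q_gt0 : 0 < q.

(** Cell [s] of block [k] of the work space; [adr k 0] also serves as the name of leaf [k]. *)
Definition adr k s := q + 6 * k + s.

Lemma adr_eq k s k' s' : s < 6 -> s' < 6 ->
  (adr k s == adr k' s') = (k == k') && (s == s').
Proof. rewrite /adr => hs hs'; lia. Qed.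

Lemma adr_inj : injective (adr^~ 0).
Proof. by move=> k k'; rewrite /adr; lia. Qed.

Lemma adr_word k s : k <= N -> s <= 6 -> adr k s < 2 ^ w.
Proof. by move: space; rewrite /adr; lia. Qed.

(** [x] fills the scratch registers 1 and 9 to 14; of these only register 1 hands a value, the root
    to visit, to a later fragment. *)
Definition registers A c sp off (x : seq nat) :=
  [:: A; nth 0 x 0; q; c; sp; 1; 6; off; pS; nth 0 x 1; nth 0 x 2; nth 0 x 3;
      nth 0 x 4; nth 0 x 5; nth 0 x 6; 0].

Definition at_state (i : nat) A c sp off (m : nat -> nat) :=
  fun i' l' m' => [/\ i' = i, m' = m &
                      exists x, l' = registers A c sp off x].

Local Notation reaches := (reaches w prog).


Ltac word := rewrite /adr; lia.

Ltac ins v :=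
  apply: (@reaches_result w prog v);
    [ by refine (f_equal Some (f_equal2 pair erefl _)); rewrite /=;
         first [ assumption | rewrite /adr; lia ]
    | by word
    | rewrite /= ].

Ltac store := apply: reaches_write; [ reflexivity | rewrite /= ].

Ltac jump := apply: reaches_jump; [ reflexivity | by rewrite /=; first [ lia | word ] | ].

Ltac pass := apply: reaches_pass; [ reflexivity | by rewrite /=; first [ lia | word ] | ].

Ltac stop := apply: reaches_done; split; [ by [] | by [] | ];
  eexists [:: _; _; _; _; _; _; _]; reflexivity.

Lemma reaches_init pT free m : q = free.+1 -> pS < 2 ^ w ->
  reaches 6 0 (pS :: pT :: free :: nseq 13 0) m
    (fun i' l' m' => [/\ i' = 6, l' = registers 0 0 0 2 [:: pT] & m' = m]).
Proof.
move=> hq pSw.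
ins 1. ins 6. ins 2. ins pS. ins 0. ins q. exact: reaches_done.
Qed.

Lemma reaches_next A c x m : pS < 2 ^ w ->
  reaches 8 61 (registers A c (adr 0 0) 2 x) m
    (fun i' l' m' => [/\ i' = 6, m' = m &
       exists x', l' = registers A c (adr 0 0) 4 (pS :: x')]).
Proof.
move=> pSw.
(* The first difference is 0 as the stack is empty; [4 - off] is positive after the pass over [T]
   only, and then starts the pass over [S]. *)
ins 0. pass. ins 4. ins 2. jump. ins 4. ins pS. jump.
apply: reaches_done; split=> //; eexists [:: _; _; _; _; _; _]; reflexivity.
Qed.

Lemma reaches_halt A c x m :
  reaches 5 61 (registers A c (adr 0 0) 4 x) m (at_state 66 A c (adr 0 0) 4 m).
Proof. ins 0. pass. ins 4. ins 0. pass. stop. Qed.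

Variable off : nat.
Hypothesis off_cases : off = 2 \/ off = 4.

Lemma reaches_leaf h i A x m : h <= N -> i < N ->
  m (adr h 0) = 0 -> m (adr h 1) = 0 ->
  reaches 12 12 (registers A (adr i 0) (adr h.+1 0) off x) m
    (at_state 61 A (adr i.+1 0) (adr h 0) off
      (update (update m (adr i off) (adr i 0)) (adr i off.+1) (adr i 0))).
Proof.
move=> hN iN m0 m1.
ins (adr h 0). ins 0. ins (adr h 1). ins 0. pass. pass.
ins (adr i off). store. ins (adr i off.+1). store. ins (adr i.+1 0). jump. stop.
Qed.

(** The node's own item becomes the marker holding its first leaf; the right child is pushed below
    the left one, which is thus visited first. *)
Lemma reaches_node h i A x m p : h.+2 < N -> i <= N -> 0 < p < q ->
  (forall a, m a < 2 ^ w) ->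
  m (adr h 0) = p -> m (adr h 1) = 0 ->
  reaches 20 12 (registers A (adr i 0) (adr h.+1 0) off x) m
    (at_state 12 A (adr i 0) (adr h.+3 0) off
      (update (update (update (update (update m (adr h 1) (adr i 0))
         (adr h.+1 0) (m p.+1)) (adr h.+1 1) 0) (adr h.+2 0) (m p)) (adr h.+2 1) 0)).
Proof.
move=> hN iN pq mw m0 m1.
have n1 : (p == adr h.+1 1) = false by rewrite /adr; lia.
have n2 : (p == adr h.+1 0) = false by rewrite /adr; lia.
have n3 : (p == adr h 1) = false by rewrite /adr; lia.
have n4 : (p.+1 == adr h 1) = false by rewrite /adr; lia.
ins (adr h 0). ins p. ins (adr h 1). ins 0. pass. jump.
store. ins (adr h.+1 0). ins p.+1.
apply: (@reaches_result w prog (m p.+1)) => //=; first by rewrite /update n4.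
store. ins (adr h.+1 1). store. ins (adr h.+2 0).
apply: (@reaches_result w prog (m p)) => //=; first by rewrite /update n1 n2 n3.
store. ins (adr h.+2 1). store. ins (adr h.+3 0). jump. stop.
Qed.

Lemma reaches_finish h i j A x m : h <= N -> i <= N -> j < N -> A.+2 < 2 ^ w ->
  (forall a, m a < 2 ^ w) -> m (adr h 1) = adr i 0 ->
  let m' := update (update m (adr j off) (adr i 0)) (adr i off.+1) (adr j 0) in
  reaches 30 12 (registers A (adr j.+1 0) (adr h.+1 0) off x) m
    (at_state 61
      (if (m' (adr j 2) == adr i 0) || (m' (adr i 3) == adr j 0) then A else A.+2)
      (adr j.+1 0) (adr h 0) off m').
Proof.
move=> hN iN jN Aw mw m1 m'.
have mw' a : m' a < 2 ^ w.
  by rewrite /m' /update; case: ifP => _; [|case: ifP => _ //]; apply: adr_word => //; lia.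
ins (adr h 0).
apply: (@reaches_result w prog (m (adr h 0))); [by [] | exact: mw | rewrite /=].
ins (adr h 1). ins (adr i 0). jump.
ins (adr j 0). ins (adr j off). store. ins (adr i off). ins (adr i off.+1). store.
rewrite -/m'. ins 2. ins (adr j 2).
apply: (@reaches_result w prog (m' (adr j 2))); [by [] | exact: mw' | rewrite /=].
have := mw' (adr j 2); have := mw' (adr i 3).
move: (m' (adr j 2)) => u.
have [v ev] : exists v, m' (adr i 3) = v by eexists.
rewrite ev => vw uw.
(* Two truncated differences add up to 0 exactly when the operands are equal. *)
ins (u - adr i 0). ins (adr i 0 - u). ins ((u - adr i 0) + (adr i 0 - u)).
case: eqP => [->|ne].
  pass. jump. stop.
jump. ins (adr i 2). ins (adr i 3).
apply: (@reaches_result w prog v); [by rewrite /= ev | by [] | rewrite /=].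
ins (v - adr j 0). ins (adr j 0 - v). ins ((v - adr j 0) + (adr j 0 - v)).
case: eqP => [->|nv].
  pass. jump. stop.
jump. ins A.+2. stop.
Qed.

Lemma reaches_loop h i A x m : 0 < h <= N ->
  reaches 2 61 (registers A (adr i 0) (adr h 0) off x) m
    (at_state 12 A (adr i 0) (adr h 0) off m).
Proof.
move=> h0. ins (6 * h). jump. stop.
Qed.

Definition missed (m : nat -> nat) (x : nat * nat) :=
  (m (adr x.2 2) != adr x.1 0) && (m (adr x.1 3) != adr x.2 0).

(** The frame clauses protect the trees, the pending stack items of enclosing nodes and the table
    entries of leaves visited earlier. *)
Record visited (t : tree) h i A m A' m' : Prop := Visited {
  visited_word : forall a, m' a < 2 ^ w;
  visited_below : forall a, a < q -> m' a = m a;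
  visited_stack : forall k s, k < h -> s < 2 -> m' (adr k s) = m (adr k s);
  visited_table : forall k s, 2 <= s < 6 ->
    ~~ ((i <= k <= i + internal_nodes t) && (off <= s <= off.+1)) ->
    m' (adr k s) = m (adr k s);
  visited_tracks : tracks (adr^~ 0) (fun k => m' (adr k off))
    (fun k => m' (adr k off.+1)) i t;
  visited_first : off = 2 -> A' = A;
  visited_second : off = 4 -> A' = A + 2 * count (missed m) (intervals i t) }.

(** Keeps the running answer within a word. *)
Lemma visited_bound t h i A m A' m' :
  visited t h i A m A' m' -> A' <= A + 2 * internal_nodes t.
Proof.
case=> _ _ _ _ _ v1 v2; case: off_cases => [/v1->|/v2->]; first lia.
by rewrite leq_add2l leq_mul2l -(size_intervals i) count_size.
Qed.

Ltac lookup := rewrite /update;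
  repeat first [ rewrite eqxx /= | case: eqP => [|_]; [ by word | ] ];
  by [].

Lemma visited_leaf h i A m : i <= N -> (forall a, m a < 2 ^ w) ->
  visited Leaf h i A m A
    (update (update m (adr i off) (adr i 0)) (adr i off.+1) (adr i 0)).
Proof.
move=> iN mw; split=> [a|a aq|k s kh s2|k s s2|||_] //.
- by rewrite /update; do 2?case: eqP => _; rewrite ?adr_word.
- by lookup.
- by lookup.
- move=> out; rewrite /update; do 2 (case: eqP => [|_]; first by move: out; rewrite /= ; word).
  by [].
- split=> [k|k|x y|] //=.
  + move=> hk; have -> : k = i by lia.
    by exists i; [lookup|left].
  + move=> hk; have -> : k = i by lia.
    by exists i; [lookup|left].
  + by rewrite addn0; split; lookup.
- by rewrite addn0.
Qed.

Lemma visited_node l r h i A m m1 A2 m2 A3 m3 :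
  h.+2 < N -> i + (internal_nodes l + internal_nodes r).+1 < N ->
  (forall a, a < q -> m1 a = m a) ->
  (forall k s, k < h -> s < 2 -> m1 (adr k s) = m (adr k s)) ->
  (forall k s, 2 <= s < 6 -> m1 (adr k s) = m (adr k s)) ->
  visited l h.+2 i A m1 A2 m2 ->
  visited r h.+1 (i + internal_nodes l).+1 A2 m2 A3 m3 ->
  let j := i + (internal_nodes l + internal_nodes r).+1 in
  let m4 := update (update m3 (adr j off) (adr i 0)) (adr i off.+1) (adr j 0) in
  visited (Node l r) h i A m
    (if (m4 (adr j 2) == adr i 0) || (m4 (adr i 3) == adr j 0) then A3 else A3.+2)
    m4.
Proof.
move=> hN iN below stack table vl vr j m4.
have frame k s : 2 <= s < 6 ->
    ~~ ((i <= k <= i + internal_nodes (Node l r)) && (off <= s <= off.+1)) ->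
    m4 (adr k s) = m (adr k s).
  move=> s26 /= out.
  have -> : m4 (adr k s) = m3 (adr k s).
    rewrite /m4 /update.
    by do 2 (case: eqP => [|_]; first by move: out; rewrite /j; word).
  by rewrite (visited_table vr) ?(visited_table vl) ?table //; move: out; lia.
split=> //.
- move=> a; rewrite /m4 /update; do 2 (case: eqP => _; first by apply: adr_word => //; lia).
  exact: visited_word vr a.
- move=> a aq; have -> : m4 a = m3 a by rewrite /m4; lookup.
  by rewrite (visited_below vr) // (visited_below vl) // below.
- move=> k s kh s2; have -> : m4 (adr k s) = m3 (adr k s) by rewrite /m4; lookup.
  by rewrite (visited_stack vr) ?(visited_stack vl) ?stack //; lia.
- have tl := visited_tracks vl; have tr := visited_tracks vr.
  (* The visit of [r] writes table entries at leaves of [r] only, so those of [l] persist. *)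
  have tl3 : tracks (adr^~ 0) (fun k => m3 (adr k off))
      (fun k => m3 (adr k off.+1)) i l.
    by apply: tracks_ext tl => k hk; split; apply: (visited_table vr); move: off_cases; lia.
  apply: tracks_ext (tracks_node adr_inj tl3 tr) => k hk.
  rewrite -/j /m4; split; rewrite {1}/update [RHS]/update.
  + case: eqP => [|_]; first word.
    by rewrite /update !adr_eq ?eqxx ?andbT //; move: off_cases; lia.
  + rewrite adr_eq ?eqxx ?andbT; [|by move: off_cases; lia..].
    case: (k =P i) => // _; rewrite /update; case: eqP => //; word.
(* In the pass over [T] the test reads the entry just written, so it succeeds and nothing is
   added. *)
- move=> o2; have -> : m4 (adr j 2) = adr i 0 by rewrite /m4 o2; lookup.
  by rewrite eqxx (visited_first vr) // (visited_first vl).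
- move=> o4; rewrite (visited_second vr) // (visited_second vl) //.
  (* In the pass over [S] cells 2 and 3 stay unchanged, so the one predicate [missed m] serves both
     subtrees and the root. *)
  have em : missed m1 =1 missed m by move=> x; rewrite /missed !table.
  have em2 : missed m2 =1 missed m.
    by move=> x; rewrite /missed !(visited_table vl) ?table // o4 ?andbF.
  rewrite (eq_count em) (eq_count em2) /= count_cat.
  rewrite /missed /= -/j !frame ?o4 ?andbF // -negb_or.
  by case: (_ || _) => /=; lia.
Qed.

(** A node takes 20 steps to open, 30 to close and 2 for each of two stack tests; with the additive
    20 of both subtrees this is 94, within the 120 available. The left subtree starts two blocks
    higher, whence [2 * internal_nodes t] in the stack bound. *)
Lemma reaches_visit t p h i A m x :
  stored_at m t p -> all (fun a => a < q) (cells m t p) ->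
  (forall a, m a < 2 ^ w) -> m (adr h 0) = p -> m (adr h 1) = 0 ->
  h + 2 * internal_nodes t + 1 < N -> i + internal_nodes t < N ->
  A + 2 * internal_nodes t < 2 ^ w ->
  reaches (100 * internal_nodes t + 20) 12
    (registers A (adr i 0) (adr h.+1 0) off x) m
    (fun pc' l' m' => exists A' x',
      [/\ pc' = 61,
          l' = registers A' (adr (i + internal_nodes t).+1 0) (adr h 0) off x'
        & visited t h i A m A' m']).
Proof.
elim: t p h i A m x => [|l IHl r IHr] p h i A m x /=.
  move=> p0 _ mw m0 m1 hN iN Aw; rewrite p0 in m0.
  have hN' : h <= N by lia.
  have iN' : i < N by lia.
  apply: (@reaches_bind _ _ 0 _ _ _ _ _ _ _ (reaches_leaf hN' iN' m0 m1)) => //.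
  move=> _ _ _ [-> -> [x' ->]]; apply: (@reaches_done _ _ 0); exists A, x'.
  by rewrite addn0; split=> //; apply: visited_leaf => //; lia.
move=> [p0 sl sr] /and3P[pq p1q]; rewrite all_cat => /andP[cl cr] mw m0 mh hN iN Aw.
have hN2 : h.+2 < N by lia.
have iN1 : i <= N by lia.
have pq' : 0 < p < q by rewrite lt0n pq andbT; apply/eqP.
apply: (@reaches_bind _ _ (100 * (internal_nodes l + internal_nodes r) + 90) _ _ _ _ _ _ _
  (reaches_node hN2 iN1 pq' mw m0 mh)); first by lia.
set m1 := update _ _ _ => _ _ _ [-> -> [x1 ->]].
have mw1 a : m1 a < 2 ^ w.
  rewrite /m1 /update; do 5 (case: eqP => [_|_]; first by [|apply: adr_word; lia|lia]).
  by [].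
have below1 a : a < q -> m1 a = m a by move=> aq; rewrite /m1; lookup.
have stack1 k s : k < h -> s < 2 -> m1 (adr k s) = m (adr k s).
  by move=> kh s2; rewrite /m1; lookup.
have table1 k s : 2 <= s < 6 -> m1 (adr k s) = m (adr k s).
  by move=> s26; rewrite /m1; lookup.
have [sl1 cl1] := stored_at_frame below1 cl sl.
have m1a : m1 (adr h.+2 0) = m p by rewrite /m1; lookup.
have m1b : m1 (adr h.+2 1) = 0 by rewrite /m1; lookup.
have m1c : m1 (adr h.+1 0) = m p.+1 by rewrite /m1; lookup.
have m1d : m1 (adr h.+1 1) = 0 by rewrite /m1; lookup.
have m1e : m1 (adr h 1) = adr i 0 by rewrite /m1; lookup.
clearbody m1; rewrite -cl1 in cl.
apply: (@reaches_bind _ _ (100 * internal_nodes r + 70) _ _ _ _ _ _ _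
  (IHl _ h.+2 i A m1 x1 sl1 cl mw1 m1a m1b _ _ _)); try lia.
move=> _ _ m2 [A2 [x2 [-> -> vl]]].
have A2b := visited_bound vl.
have hb2 : 0 < h.+2 <= N by lia.
apply: (@reaches_bind _ _ (100 * internal_nodes r + 68) _ _ _ _ _ _ _
  (reaches_loop m2 hb2)); first lia.
move=> _ _ _ [-> -> [x3 ->]].
have below2 a : a < q -> m2 a = m a.
  by move=> aq; rewrite (visited_below vl) // below1.
have [sr2 cr2] := stored_at_frame below2 cr sr.
rewrite -cr2 in cr.
have m2c : m2 (adr h.+1 0) = m p.+1 by rewrite (visited_stack vl).
have m2d : m2 (adr h.+1 1) = 0 by rewrite (visited_stack vl).
have m2e : m2 (adr h 1) = adr i 0 by rewrite (visited_stack vl).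
apply: (@reaches_bind _ _ 48 _ _ _ _ _ _ _
  (IHr _ h.+1 (i + internal_nodes l).+1 A2 m2 x3 sr2 cr (visited_word vl) m2c m2d _ _ _));
  try lia.
move=> _ _ m3 [A3 [x4 [-> -> vr]]].
have A3b := visited_bound vr.
have hb1 : 0 < h.+1 <= N by lia.
apply: (@reaches_bind _ _ 46 _ _ _ _ _ _ _ (reaches_loop m3 hb1)) => //.
move=> _ _ _ [-> -> [x5 ->]].
have m3e : m3 (adr h 1) = adr i 0 by rewrite (visited_stack vr).
have ej : (i + internal_nodes l).+1 + internal_nodes r
        = i + (internal_nodes l + internal_nodes r).+1 by lia.
rewrite ej.
have hN0 : h <= N by lia.
have jN : i + (internal_nodes l + internal_nodes r).+1 < N by lia.
have A3w : A3.+2 < 2 ^ w by lia.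
apply: (@reaches_bind _ _ 0 _ _ _ _ _ _ _
  (reaches_finish hN0 iN1 jN A3w (visited_word vr) m3e)) => //.
move=> _ _ _ [-> -> [x6 ->]]; apply: (@reaches_done _ _ 0).
eexists; exists x6; split=> //.
exact: visited_node vl vr.
Qed.

Lemma reaches_push A c sp p x m : p < 2 ^ w ->
  reaches 6 6 (registers A c sp off (p :: x)) m
    (at_state 12 A (adr 0 0) (adr 1 0) off
      (update (update m (adr 0 0) p) (adr 0 1) 0)).
Proof.
move=> pw.
ins (adr 0 0). ins (adr 0 0). store. ins (adr 0 1). store. ins (adr 1 0). stop.
Qed.

Lemma reaches_tree t p A c sp m x :
  stored_at m t p -> all (fun a => a < q) (cells m t p) ->
  (forall a, m a < 2 ^ w) -> p < 2 ^ w ->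
  2 * internal_nodes t + 1 < N -> A + 2 * internal_nodes t < 2 ^ w ->
  reaches (100 * internal_nodes t + 26) 6 (registers A c sp off (p :: x)) m
    (fun pc' l' m' => exists A' c' x',
      [/\ pc' = 61, l' = registers A' c' (adr 0 0) off x'
        & visited t 0 0 A m A' m']).
Proof.
move=> st ct mw pw tN Aw.
apply: (@reaches_bind _ _ (100 * internal_nodes t + 20) _ _ _ _ _ _ _
  (reaches_push m pw)); first by lia.
set m1 := update _ _ _ => _ _ _ [-> -> [x1 ->]].
have mw1 a : m1 a < 2 ^ w.
  by rewrite /m1 /update; do 2 (case: eqP => [_|_]; first by [|lia]).
have below1 a : a < q -> m1 a = m a by move=> aq; rewrite /m1; lookup.
have table1 k s : 2 <= s < 6 -> m1 (adr k s) = m (adr k s).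
  by move=> s26; rewrite /m1; lookup.
have m1a : m1 (adr 0 0) = p by rewrite /m1; lookup.
have m1b : m1 (adr 0 1) = 0 by rewrite /m1; lookup.
clearbody m1.
have [st1 ct1] := stored_at_frame below1 ct st; rewrite -ct1 in ct.
apply: (@reaches_bind _ _ 0 _ _ _ _ _ _ _
  (reaches_visit st1 ct mw1 m1a m1b _ _ Aw)) => //; try lia.
move=> _ _ m' [A' [x' [-> -> [v1 v2 v3 v4 v5 v6 v7]]]].
apply: (@reaches_done _ _ 0); exists A', (adr (0 + internal_nodes t).+1 0), x'; split=> //.
split=> //.
- by move=> a aq; rewrite v2 ?below1.
- by move=> k s s26 out; rewrite v4 ?table1.
- move/v7 ->; congr (_ + 2 * _); apply: eq_count => y.
  by rewrite /missed !table1.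
Qed.

End Pass.

(** * Assembly of the two passes and the choice of the word length *)

Lemma prog_correct w n S T pS pT free m :
  internal_nodes S = n -> internal_nodes T = n ->
  free + 12 * n + 40 < 2 ^ w -> valid_input w S T pS pT free m ->
  outputs_within w prog (300 * n.+1) (initial_state pS pT free m)
    (2 * count [predC intervals 0 T] (intervals 0 S)).
Proof.
move=> Sn Tn fw [[sS sT] _ + _ mw]; rewrite all_cat => /andP[cS cT].
(* Since [q] is positive, leaf addresses are nonzero and mark finished nodes apart from the 0 of
   unvisited items; [N] exceeds the stack need [2 * n + 1]. *)
pose q := free.+1; pose N := 2 * n + 4.
have space : q + 6 * N + 6 < 2 ^ w by rewrite /q /N; lia.
have q0 : 0 < q by [].
have leq_q s : all (fun a => a < free) s -> all (fun a => a < q) s.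
  by apply: sub_all => a; rewrite /q; lia.
have root_word t p : stored_at m t p -> all (fun a => a < free) (cells m t p) ->
    p < 2 ^ w.
  by case: t => [|l r] /= => [-> _|_ /and3P[+ _ _]]; lia.
have pSw := root_word _ _ sS cS; have pTw := root_word _ _ sT cT.
have below m' : (forall a, a < q -> m' a = m a) -> stored_at m' S pS /\
    cells m' S pS = cells m S pS.
  by move=> e; apply: stored_at_frame (leq_q _ cS) sS.
have run : reaches w prog (200 * n + 80) 0 (pS :: pT :: free :: nseq 13 0) m
    (fun i' l' _ => i' = 66 /\
       nth 0 l' 0 = 2 * count [predC intervals 0 T] (intervals 0 S)).
  apply: (@reaches_bind _ _ (200 * n + 70) _ _ _ _ _ _ _
    (@reaches_init _ _ _ _ space q0 pT free m erefl pSw)); first lia.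
  move=> _ _ _ [-> -> ->].
  apply: (@reaches_bind _ _ (100 * n + 44) _ _ _ _ _ _ _
    (reaches_tree space q0 (or_introl erefl) sT
       (leq_q _ cT) mw pTw _ _)); rewrite ?Tn; try lia.
  move=> _ _ m1 [A1 [c1 [x1 [-> -> v1]]]].
  have A10 : A1 = 0 := visited_first v1 erefl.
  apply: (@reaches_bind _ _ (100 * n + 36) _ _ _ _ _ _ _
    (reaches_next space q0 m1 pSw)); first lia.
  move=> _ _ _ [-> -> [x2 ->]].
  have [sS1 cS1] := below _ (visited_below v1).
  apply: (@reaches_bind _ _ 5 _ _ _ _ _ _ _
    (reaches_tree space q0 (or_intror erefl) sS1 _
       (visited_word v1) pSw _ _)); rewrite ?Sn ?cS1 ?leq_q; try lia.
  move=> _ _ m2 [A2 [c2 [x3 [-> -> v2]]]].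
  apply: (@reaches_bind _ _ 0 _ _ _ _ _ _ _
    (reaches_halt space q0 m2)) => //.
  move=> _ _ _ [-> -> [x4 ->]]; apply: (@reaches_done _ _ 0); split=> //=.
  rewrite (visited_second v2 erefl) A10; congr (2 * _).
  (* The bounds [i < j <= n] on intervals of [S] make the table lookup a membership test for [T]. *)
  apply: eq_in_count => -[i j] /intervals_bounds ij.
  rewrite /missed /= -negb_or.
  congr (~~ _); apply: tracks_mem Tn (visited_tracks v1) _; last by lia.
  exact: adr_inj space q0.
have [|t [i' [r' [l' [m' [tb e er [ei eA]]]]]]] := run (nth 0 [:: pS; pT; free]).
  by case=> [|[|[|x]]] //; rewrite [LHS]nth_default // -[RHS]/(nth 0 (nseq 13 0) x) nth_nseq if_same.
exists t, (State i' r' m'); split=> //=; first by lia.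
  by rewrite ei.
by rewrite er.
Qed.

Lemma valid_input_widen w w' S T pS pT free m : w <= w' ->
  valid_input w S T pS pT free m -> valid_input w' S T pS pT free m.
Proof.
move=> ww' [s u c fw mw]; have le := leq_pexp2l (isT : 0 < 2) ww'.
by split=> // [|a]; [apply: leq_trans le|apply: leq_trans (mw a) le].
Qed.

Theorem corollary2 :
  exists (P : program) (C : nat),
  forall k : nat, exists2 c : nat, k <= c &
  forall (n : nat) (S T : tree) (pS pT free : nat) (m : nat -> nat),
    internal_nodes S = n -> internal_nodes T = n ->
    valid_input (k * bits n) S T pS pT free m ->
    exists A d : nat,
      [/\ outputs_within (c * bits n) P (C * n.+1)
            (initial_state pS pT free m) A,
          rotation_distance S T d
        & d <= A <= 2 * d].
Proof.
exists prog, 300 => k; exists (k + 6); first by lia.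
move=> n S T pS pT free m Sn Tn valid.
have [d dd dA] := rotation_distance_approximation (etrans Sn (esym Tn)).
exists (2 * count [predC intervals 0 T] (intervals 0 S)), d; split=> //.
apply: prog_correct => //; last first.
  by apply: valid_input_widen valid; rewrite leq_mul2r leq_addr orbT.
have [_ _ _ fw _] := valid.
have nb : n < 2 ^ bits n by apply: trunc_log_ltn.
have b2 : 2 <= 2 ^ bits n by rewrite -{1}(expn1 2) leq_exp2l.
rewrite mulnDl expnD [6 * _]mulnC [2 ^ (_ * 6)]expnM.
move: (2 ^ (k * bits n)) (2 ^ bits n) fw nb b2 => Y X fY nX X2.
(* [n < X] and [2 <= X] put [12 * n + 40] below [32 * X]; the exponent 6 of [k + 6] yields the
   factor [2 ^ 5]. *)
have X6 : 32 * X <= X ^ 6 by rewrite expnSr leq_mul2r (@leq_exp2r 2 X 5) // X2 orbT.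
move: (X ^ 6) X6 => Z X6.
(* For positive [Y] and [Z] this turns the separate bounds on [free] and on the work space into one
   on [2 ^ w]. *)
have YZ : Y + Z <= (Y * Z).+1.
  case: Y Z fY X6 => [//|Y] [|Z] _ X6; first by lia.
  by rewrite mulSn mulnS; move: (Y * Z); lia.
lia.
Qed.
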